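(* Let $n\in\mathbb{Z}_{\ge 1}$ and let $q\in\mathbb{R}$ with $0<q<n$ and fractional part $\widehat q := q-\lfloor q\rfloor\neq 0$. Then the SOS rank of the unweighted minimum knapsack instance $\mathrm{MK}(q)$ on $n$ variables is upper bounded by $$ \begin{cases} O\left(\sqrt{n}\,\log(2/\widehat q)+\sqrt{n\lfloor q\rfloor}\,\log n\right) & \text{if } 0<q<\lfloor n/2\rfloor,\\[4pt] O\left(n-\lfloor q\rfloor\right) & \text{if } \lfloor n/2\rfloor<q<n, \end{cases} $$ where the constants implied by $O(\cdot)$ are absolute (independent of $n$ and $q$).
   Context: For $\mathbf{x}\in\{0,1\}^n$ write $|\mathbf{x}|=\sum_{i=1}^n x_i$. The instance $\mathrm{MK}(q)$ is the problem of minimizing $|\mathbf{x}|$ subject to $|\mathbf{x}|\ge q$, $\mathbf{x}\in\{0,1\}^n$; for $0\le q\le n$ its optimal value is $\lceil q\rceil$. A polynomial in $\mathbb{R}[x_1,\dots,x_n]$ is SOS if it is a finite sum of squares of real polynomials. For $0\le q\le n$, a degree-$d$ SOS certificate of optimality for $\mathrm{MK}(q)$ consists of SOS polynomials $s_0,s_1\in\mathbb{R}[x_1,\dots,x_n]$ with $\deg(s_0)\le 2d+2$, $\deg(s_1)\le 2d$ and $$|\mathbf{x}|-\lceil q\rceil = s_0(\mathbf{x})+s_1(\mathbf{x})(|\mathbf{x}|-q)\quad\text{for all }\mathbf{x}\in\{0,1\}^n.$$ The SOS rank of $\mathrm{MK}(q)$ is the smallest $d\in\mathbb{Z}_{\ge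 0}$ for which such a certificate exists. *)

(* Defs.v *)
From HB Require Import structures.
From mathcomp Require Import all_boot all_order all_algebra.
From mathcomp Require Import mpoly.

Set Implicit Arguments.
Unset Strict Implicit.
Unset Printing Implicit Defensive.

Import Order.TTheory GRing.Theory Num.Theory.
Local Open Scope ring_scope.

Definition is_sos (R : realFieldType) (n : nat) (p : {mpoly R[n]}) : Prop :=
  exists s : seq {mpoly R[n]}, p = \sum_(r <- s) r ^+ 2.

(* [msize p] is [deg p + 1], and [msize 0 = 0]: the zero polynomial satisfies
   every degree bound. *)
Definition mpoly_deg_le (R : realFieldType) (n : nat) (p : {mpoly R[n]})
  (k : nat) : Prop := (msize p <= k.+1)%N.

(* Points of the cube {0,1}^n are finite functions to [bool], embedded in R^n
   through [true |-> 1] and [false |-> 0]. *)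
Definition cube_pt (R : realFieldType) (n : nat) (x : {ffun 'I_n -> bool})
  : 'I_n -> R := fun i => (x i)%:R.

Definition hamming (R : realFieldType) (n : nat) (x : {ffun 'I_n -> bool}) : R :=
  \sum_(i < n) cube_pt R x i.

(* [Num.ceil q] is the optimal value of MK(q) when 0 <= q <= n. *)
Definition mk_certificate (R : archiRealFieldType) (n : nat) (q : R) (d : nat)
  : Prop :=
  exists s0 s1 : {mpoly R[n]},
    [/\ is_sos s0, is_sos s1,
        mpoly_deg_le s0 (2 * d + 2)%N, mpoly_deg_le s1 (2 * d)%N
      & forall x : {ffun 'I_n -> bool},
          hamming R x - (Num.ceil q)%:~R =
          s0.@[cube_pt R x] + s1.@[cube_pt R x] * (hamming R x - q)].

Definition is_sos_rank (R : archiRealFieldType) (n : nat) (q : R) (d : nat)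
  : Prop :=
  mk_certificate n q d /\
  (forall d' : nat, mk_certificate n q d' -> (d <= d')%N).

(* Main.v *)
Require Import Defs.
From HB Require Import structures.
From mathcomp Require Import all_boot all_order all_algebra.
From mathcomp Require Import reals exp.
From mathcomp Require Import mpoly complex polyrcf ring lra zify.

(** Write X for |x|, m for the floor of q, and look for certificates that are
    polynomials in X. A univariate polynomial is a sum of squares on the cube
    as soon as it is a combination of squares multiplied by falling factorials
    (X)_k or (n - X)_k: these count injective k-tuples of satisfied literals,
    hence are sums of squared monomials of degree k.

    Large q: s1 is divisible by (n - X)_(n-m), so it vanishes for X > m, where s0
    interpolates X - (m+1). For X <= m, dividing by (n - X)_(n-m) leaves an
    arbitrary polynomial r, and r = ((r+1)/2)^2 - ((r-1)/2)^2 where the negative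
    square is absorbed by the negative number X - q. The degree is 2(n - m).

    Small q: s1 interpolates (m+1-i)/(q-i) at i <= m and 0 at m+1, by means of
    squares of Lagrange polynomials whose factors X - j are damped by Fejer
    kernels of degree O(sqrt(n / |i-j|)), so that they stay bounded on [m+2, n];
    O(log(m/(q-m))) further kernels of degree O(sqrt n) bring s1 below 1/2 there.
    Then X - (m+1) - s1 (X - q) vanishes at 0..m+1 and is nonnegative on [m+2, n]:
    it is (X)_(m+2) times a polynomial that is nonnegative on [m+2, n], to which a
    factorization argument in the manner of Lukacs applies. *)

Set Implicit Arguments.
Unset Strict Implicit.
Unset Printing Implicit Defensive.

Import Order.TTheory GRing.Theory Num.Theory.
Local Open Scope ring_scope.

(** * Sums of squares on the cube for univariate polynomials in the Hamming weight *)

Section CubeSOS.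
Variables (R : rcfType) (n : nat).
Implicit Types (p q : {poly R}) (k l : nat).

(** The bound is on the polynomials being squared, so it is half the SOS degree. Equality is asked
    only on the cube, which avoids reducing modulo x_i^2 = x_i. *)
Definition cube_sos k (p : {poly R}) : Prop :=
  exists2 s : seq {mpoly R[n]}, {in s, forall r, msize r <= k.+1}%N &
    forall x : {ffun 'I_n -> bool},
      p.[hamming R x] = \sum_(r <- s) (r.@[cube_pt R x]) ^+ 2.

Lemma cube_sos0 k : cube_sos k 0.
Proof. by exists [::] => // x; rewrite horner0 big_nil. Qed.

Lemma cube_sosW k1 k2 p : (k1 <= k2)%N -> cube_sos k1 p -> cube_sos k2 p.
Proof.
move=> le12 [s hs Es]; exists s => // r rs.
exact: leq_trans (hs r rs) _.
Qed.

Lemma cube_sosD k p q : cube_sos k p -> cube_sos k q -> cube_sos k (p + q).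
Proof.
move=> [s hs Es] [t ht Et]; exists (s ++ t) => [r|x].
  by rewrite mem_cat => /orP[/hs|/ht].
by rewrite hornerD Es Et big_cat.
Qed.

Lemma cube_sos_sum (I : Type) (r : seq I) (P : pred I) (F : I -> {poly R}) k :
  (forall i, P i -> cube_sos k (F i)) -> cube_sos k (\sum_(i <- r | P i) F i).
Proof.
move=> h; elim/big_ind: _ => //; [exact: cube_sos0|exact: cube_sosD].
Qed.

Lemma msizeM_deg (p q : {mpoly R[n]}) k l :
  (msize p <= k.+1 -> msize q <= l.+1 -> msize (p * q) <= (k + l).+1)%N.
Proof.
have [->|p0] := eqVneq p 0; first by rewrite mul0r msize0.
have [->|q0] := eqVneq q 0; first by rewrite mulr0 msize0.
rewrite msizeM //; move: (msize p) (msize q) => a b.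
lia.
Qed.

Lemma cube_sosM k l p q :
  cube_sos k p -> cube_sos l q -> cube_sos (k + l) (p * q).
Proof.
move=> [s hs Es] [t ht Et].
exists [seq u * v | u <- s, v <- t] => [r|x].
  case/allpairsP=> -[u v] /= [/hs hu /ht hv ->].
  exact: msizeM_deg.
rewrite hornerM Es Et big_allpairs_dep mulr_suml; apply: eq_bigr => u _.
by rewrite mulr_sumr; apply: eq_bigr => v _; rewrite mevalM exprMn.
Qed.

Lemma msize_exp_le (r : {mpoly R[n]}) d i :
  (msize r <= d.+1 -> msize (r ^+ i) <= (i * d).+1)%N.
Proof.
move=> hr; elim: i => [|i IH]; first by rewrite expr0 msize1.
by rewrite exprS mulSn; apply: msizeM_deg.
Qed.

Lemma msize_prod_le (I : Type) (s : seq I) (F : I -> {mpoly R[n]}) :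
  (forall i, msize (F i) <= 2)%N -> (msize (\prod_(i <- s) F i) <= (size s).+1)%N.
Proof.
move=> h; elim: s => [|i s IH]; first by rewrite big_nil msize1.
by rewrite big_cons -[size (i :: s)]/(1 + size s)%N; apply: msizeM_deg.
Qed.

Lemma msize_sum_le (I : Type) (s : seq I) (F : I -> {mpoly R[n]}) d :
  (forall i, msize (F i) <= d)%N -> (msize (\sum_(i <- s) F i) <= d)%N.
Proof.
move=> h; elim/big_ind: _ => //; first by rewrite msize0.
by move=> x y hx hy; apply: leq_trans (msizeD_le _ _) _; rewrite geq_max hx.
Qed.

(** Substituting the linear form x_1 + ... + x_n for the variable of [p] keeps the degree. *)
Lemma cube_sos_sqr k p : (size p <= k.+1)%N -> cube_sos k (p ^+ 2).
Proof.
move=> hp; pose e : {mpoly R[n]} := \sum_(i < n) 'X_i.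
have he : (msize e <= 2)%N by apply: msize_sum_le => i; rewrite msizeX mdeg1.
exists [:: \sum_(i < size p) p`_i *: e ^+ i] => [r|x].
  rewrite inE => /eqP ->; apply: msize_sum_le => i.
  apply: leq_trans (msizeZ_le _ _) _.
  apply: leq_trans (msize_exp_le i (he : msize e <= 1.+1)%N) _.
  by rewrite muln1 (leq_trans (ltn_ord i)).
rewrite big_seq1 horner_exp horner_coef; congr (_ ^+ 2).
rewrite raddf_sum /=; apply: eq_bigr => i _.
rewrite mevalZ rmorphXn /=; congr (_ * _ ^+ _).
by rewrite raddf_sum /=; apply: eq_bigr => j _; rewrite mevalXU.
Qed.

Lemma cube_sosC k c : 0 <= c -> cube_sos k c%:P.
Proof.
move=> c0; rewrite -[c]sqr_sqrtr // polyC_exp; apply: cube_sos_sqr.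
by rewrite size_polyC; case: eqP.
Qed.

Lemma cube_sosZ k c p : 0 <= c -> cube_sos k p -> cube_sos k (c *: p).
Proof. by move=> c0 hp; rewrite -mul_polyC -[k]add0n; apply/cube_sosM/hp/cube_sosC. Qed.

(* Counting the injective k-tuples inside the set of literals that hold. *)
Lemma cube_sos_ffact_literals k p (y : 'I_n -> {mpoly R[n]})
    (P : {ffun 'I_n -> bool} -> pred 'I_n) :
  (forall i, msize (y i) <= 2)%N ->
  (forall x i, (y i).@[cube_pt R x] = (P x i)%:R) ->
  (forall x, p.[hamming R x] = (#|P x| ^_ k)%:R) -> cube_sos k p.
Proof.
move=> hy Ey Ep.
exists [seq \prod_(i <- tval t) y i | t <- enum [set t : k.-tuple 'I_n | uniq t]].
  move=> r /mapP[t _ ->].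
  by apply: leq_trans (msize_prod_le _ hy) _; rewrite size_tuple.
move=> x; rewrite Ep -card_uniq_tuples big_map big_enum /= -sum1_card natr_sum.
rewrite (eq_bigl (fun t => (t \in [set t : k.-tuple 'I_n | uniq t]) && all (P x) t));
  last by move=> t; rewrite !inE andbC.
rewrite big_mkcondr /=; apply: eq_bigr => t _.
rewrite rmorph_prod /=; under eq_bigr do rewrite Ey.
elim: (tval t) => [|i s IH]; first by rewrite big_nil expr1n.
rewrite big_cons /=; case: (P x i) => /=; first by rewrite mul1r.
by rewrite mul0r expr0n.
Qed.

(** The falling factorial (X)_k and, exchanging the roles of 0 and 1, (n - X)_k. *)
Definition ffp k : {poly R} := \prod_(i < k) ('X - (i%:R)%:P).
Definition cffp k : {poly R} := \prod_(i < k) ((n%:R - i%:R)%:P - 'X).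

Lemma hammingE (x : {ffun 'I_n -> bool}) : hamming R x = #|[pred i | x i]|%:R.
Proof.
rewrite /hamming /cube_pt -sum1_card natr_sum [RHS]big_mkcond /=.
by apply: eq_bigr => i _; rewrite inE; case: (x i).
Qed.

Lemma prod_natB (a k : nat) :
  \prod_(i < k) (a%:R - i%:R : R) = (a ^_ k)%:R.
Proof.
rewrite ffact_prod natr_prod.
have [ka|ak] := leqP k a.
  by apply: eq_bigr => i _; rewrite natrB // ltnW // (leq_trans (ltn_ord i)).
by rewrite (bigD1 (Ordinal ak)) //= subrr mul0r (bigD1 (Ordinal ak)) //= subnn mul0r.
Qed.

Lemma cube_sos_ffp k : cube_sos k (ffp k).
Proof.
apply: (@cube_sos_ffact_literals _ _ (fun i => 'X_i) (fun x i => x i)).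
- by move=> i; rewrite msizeX mdeg1.
- by move=> x i; rewrite mevalXU.
move=> x; rewrite horner_prod -prod_natB hammingE.
by apply: eq_bigr => i _; rewrite hornerXsubC.
Qed.

Lemma cube_sos_cffp k : cube_sos k (cffp k).
Proof.
apply: (@cube_sos_ffact_literals _ _ (fun i => 1 - 'X_i) (fun x i => ~~ x i)).
- move=> i; apply: leq_trans (msizeD_le _ _) _.
  by rewrite msizeN msize1 msizeX mdeg1.
- move=> x i; rewrite mevalB meval1 mevalXU /cube_pt.
  by case: (x i); rewrite ?subrr ?subr0.
move=> x; rewrite horner_prod -prod_natB hammingE.
have E : (#|[pred i | x i]| + #|[pred i | ~~ x i]| = n)%N.
  by rewrite -[RHS](card_ord n) -(cardC [pred i | x i]).
have En : n%:R = #|[pred i | x i]|%:R + #|[pred i | ~~ x i]|%:R :> R.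
  by rewrite -natrD E.
apply: eq_bigr => i _; rewrite !hornerE En.
by rewrite -[X in _ = X%:R - _]/#|[pred i | ~~ x i]|; ring.
Qed.

End CubeSOS.

(** Squaring doubles the bounds d + 1 and d into 2d + 2 and 2d; the univariate identity is then
    evaluated at X = |x|. *)
Lemma mk_certificate_cube_sos (R : realType) n (q : R) d (s0 s1 : {poly R}) :
  cube_sos n d.+1 s0 -> cube_sos n d s1 ->
  'X - ((Num.ceil q)%:~R)%:P = s0 + s1 * ('X - q%:P) -> mk_certificate n q d.
Proof.
have deg k (s : seq {mpoly R[n]}) : {in s, forall r, msize r <= k.+1}%N ->
    (msize (\sum_(r <- s) r ^+ 2) <= (2 * k).+1)%N.
  move=> hs; rewrite big_seq; elim/big_ind: _ => //; first by rewrite msize0.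
    by move=> x y hx hy; apply: leq_trans (msizeD_le _ _) _; rewrite geq_max hx.
  by move=> r /hs; apply: msize_exp_le.
move=> [t0 h0 E0] [t1 h1 E1] E.
exists (\sum_(r <- t0) r ^+ 2), (\sum_(r <- t1) r ^+ 2); split.
- by exists t0.
- by exists t1.
- by rewrite /mpoly_deg_le -mulnSr; apply: deg.
- exact: deg.
move=> x; move/(congr1 (fun p => p.[hamming R x])): E.
rewrite hornerXsubC hornerD hornerM hornerXsubC E0 E1 => ->.
by rewrite !raddf_sum /=; do !congr (_ + _); [|congr (_ * _)];
  apply: eq_bigr => r _; rewrite rmorphXn.
Qed.

(** * Quadratic factors and signs at limit points *)

Lemma poly_quadratic_factor (R : rcfType) (p : {poly R}) :
  (1 < size p)%N -> (forall x, ~~ root p x) ->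
  exists x y, y != 0 /\ exists g, p = (('X - x%:P) ^+ 2 + (y ^+ 2)%:P) * g.
Proof.
move=> sp nr.
have /closed_rootP[z] : size (map_poly (real_complex R) p) != 1%N.
  by rewrite size_map_poly gtn_eqF.
have zE : z = real_complex R (complex.Re z) + 'i%C * real_complex R (complex.Im z).
  by case: (z) => u v; simpc.
move: (complex.Re z) (complex.Im z) zE => x y zE rz.
have y0 : y != 0.
  apply/eqP => y0; move: rz; rewrite zE y0 rmorph0 mulr0 addr0 fmorph_root.
  by rewrite (negPf (nr x)).
exists x, y; split=> //.
set Q := _ + _.
have sQ : size Q = 3%N.
  rewrite size_polyDl ?size_exp_XsubC //.
  by rewrite size_polyC; case: eqP.
exists (p %/ Q); rewrite mulrC [LHS](divp_eq p Q).
(* The nonreal root x + iy of [p] is also a root of [Q], hence of the remainder, which is real of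
   degree at most 1 and so must be zero. *)
suff -> : p %% Q = 0 by rewrite addr0.
have Q0 : Q != 0 by rewrite -size_poly_eq0 sQ.
have sr : (size (p %% Q)%R <= 2)%N by rewrite -ltnS -sQ ltn_modp.
have rE : p %% Q = ((p %% Q)`_0)%:P + (p %% Q)`_1 *: 'X.
  apply/polyP => i; rewrite coefD coefC coefZ coefX.
  case: i => [|[|i]] /=; rewrite ?mulr0 ?mulr1 ?addr0 ?add0r //.
  by rewrite nth_default // (leq_trans sr).
have Qz : (map_poly (real_complex R) Q).[z] = 0.
  rewrite rmorphD rmorphXn rmorphB /= map_polyX !map_polyC /= !hornerE zE.
  rewrite [real_complex R x + _]addrC addrK exprMn -!rmorphXn /= (_ : 'i%C ^+ 2 = -1);
    last by rewrite expr2; simpc.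
  by rewrite rmorphXn /= mulN1r addNr.
move: rz; rewrite rootE {1}(divp_eq p Q) rmorphD rmorphM /= hornerD hornerM Qz mulr0 add0r rE.
rewrite rmorphD /= map_polyZ /= map_polyX map_polyC /= !hornerE zE.
move: (_`_0) (_`_1) => r0 r1 /eqP E.
have : ((r0 + r1 * x) +i* (r1 * y))%C = 0 :> R[i]%C.
  by rewrite -[RHS]E; apply/eqP; rewrite eq_complex /=; apply/andP; split; apply/eqP; ring.
case=> E0 /eqP; rewrite mulf_eq0 (negPf y0) orbF => /eqP r10.
by move: E0; rewrite r10 mul0r addr0 => ->; rewrite polyC0 scale0r addr0.
Qed.

Lemma horner_ge0_limit (R : rcfType) (p : {poly R}) (z : R) (P : R -> Prop) :
  (forall d : R, 0 < d -> exists2 x, P x & `|x - z| < d) ->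
  (forall x, P x -> 0 <= p.[x]) -> 0 <= p.[z].
Proof.
move=> hP pP; rewrite leNgt; apply/negP => pz.
have /(poly_cont z p)[d d0 hd] : 0 < - p.[z] by rewrite oppr_gt0.
have [x /pP px /hd] := hP d d0.
by rewrite ltr_norml; lra.
Qed.

Lemma exists_near_left (R : realFieldType) (a z d : R) :
  a < z -> 0 < d -> exists2 x, a < x < z & `|x - z| < d.
Proof.
move=> az d0; exists (Num.max (z - d / 2) ((a + z) / 2)).
  by case: (leP (z - d / 2) ((a + z) / 2)) => h; apply/andP; split; lra.
by rewrite ltr_norml; case: (leP (z - d / 2) ((a + z) / 2)) => h; apply/andP; split; lra.
Qed.

Lemma exists_near_right (R : realFieldType) (z b d : R) :
  z < b -> 0 < d -> exists2 x, z < x < b & `|x - z| < d.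
Proof.
move=> az d0; exists (Num.min (z + d / 2) ((b + z) / 2)).
  by case: (leP (z + d / 2) ((b + z) / 2)) => h; apply/andP; split; lra.
by rewrite ltr_norml; case: (leP (z + d / 2) ((b + z) / 2)) => h; apply/andP; split; lra.
Qed.

(** * Polynomials nonnegative on an interval *)

Section Cone.
Variables (R : rcfType) (n : nat) (a : R).
Hypothesis an : a < n%:R.

(* On multiples of the falling factorial (X)_a, the factor X - a only extends
   that falling factorial, so the members of this cone become sums of squares
   on the cube after multiplication by (X)_a. *)
Definition sos_cone k (p : {poly R}) : Prop :=
  exists A B, [/\ cube_sos n k A, cube_sos n k B & p = A + ('X - a%:P) * B].

Lemma sos_coneM l k s p : cube_sos n l s -> sos_cone k p -> sos_cone (l + k) (s * p).
Proof.
move=> hs [A [B [hA hB ->]]]; exists (s * A), (s * B).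
by split; [exact: cube_sosM|exact: cube_sosM|ring].
Qed.

(** Write X - z = (X - a) + (a - z) with a nonnegative constant; the term in (X - a)^2 B joins the
    part free of X - a. *)
Lemma sos_cone_XsubC k z p : z <= a -> sos_cone k p -> sos_cone k.+1 (('X - z%:P) * p).
Proof.
move=> za [A [B [hA hB ->]]];
exists ((a - z) *: A + ('X - a%:P) ^+ 2 * B), (A + (a - z) *: B).
have az : 0 <= a - z by rewrite subr_ge0.
split.
- apply: cube_sosD; first exact/(@cube_sosW _ _ k)/cube_sosZ.
  by rewrite -add1n; apply: cube_sosM => //; apply: cube_sos_sqr; rewrite size_XsubC.
- by apply: (@cube_sosW _ _ k) => //; apply: cube_sosD => //; apply: cube_sosZ.
- by rewrite -!mul_polyC polyCB; ring.
Qed.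

(** Here z - X = (n - X) + (z - n), and n - X is the falling factorial (n - X)_1. *)
Lemma sos_cone_CsubX k z p : n%:R <= z -> sos_cone k p -> sos_cone k.+1 ((z%:P - 'X) * p).
Proof.
move=> za; rewrite -add1n; apply: sos_coneM.
have -> : z%:P - 'X = cffp R n 1 + (z - n%:R)%:P.
  by rewrite /cffp big_ord1 /= mulr0n subr0 polyCB; ring.
by apply: cube_sosD; [exact: cube_sos_cffp|apply: cube_sosC; rewrite subr_ge0].
Qed.

(** Induction on [k], splitting off a linear factor for a root outside the open interval, a squared
    one for a root inside, or a positive quadratic when there is no real root. Each removal costs
    one unit of [k]. *)
Lemma sos_cone_ge0 k (p : {poly R}) : (size p <= k.+1)%N ->
  (forall x, a < x < n%:R -> 0 <= p.[x]) -> sos_cone k p.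
Proof.
elim/ltn_ind: k p => k IH p sp hp.
pose c := (a + n%:R) / 2.
have hc : a < c < n%:R by rewrite /c !midf_lt.
have [s1|s1] := leqP (size p) 1.
  exists p, 0; split; [|exact: cube_sos0|by rewrite mulr0 addr0].
  have E := size1_polyC s1; rewrite E; apply: cube_sosC.
  by have := hp c hc; rewrite {1}E hornerC.
clear c hc; have k0 : (0 < k)%N by rewrite -ltnS (leq_trans s1).
have sz q g : p = q * g -> (1 < size q)%N -> (size g <= k - (size q).-2)%N.
  move=> E hq; have g0 : g != 0 by apply/eqP => g0; move: s1; rewrite E g0 mulr0 size_poly0.
  have q0 : q != 0 by apply/eqP => q0; move: s1; rewrite E q0 mul0r size_poly0.
  by move: sp; rewrite E size_mul //; move: hq; move: (size q) (size g); lia.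
have szX z g : p = ('X - z%:P) * g -> (size g <= k.-1.+1)%N.
  by move/sz; rewrite size_XsubC prednK // subn0 => ->.
have [[z rz]|nr] : (exists z, root p z) \/ (forall x, ~~ root p x).
  have p0 : p != 0 by apply/eqP => p0; move: s1; rewrite p0 size_poly0.
  have hr x : root p x = (x \in rootsR p) by rewrite -(roots_on_rootsR p0) in_itv.
  case E: (rootsR p) => [|z s]; [right=> x|left; exists z]; rewrite hr E //.
  exact: mem_head.
- have /factor_theorem[g E0] := rz.
  have {E0} E : p = ('X - z%:P) * g by rewrite mulrC.
  have [za|az] := leP z a.
    rewrite E -(prednK k0); apply: sos_cone_XsubC => //.
    apply: IH; [by rewrite prednK|exact: szX E|].
    move=> x hx; have := hp x hx; rewrite E hornerM hornerXsubC pmulr_rge0 //.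
    by move: hx => /andP[]; lra.
  have [nz|zn] := leP n%:R z.
    have E' : p = (z%:P - 'X) * - g by rewrite E; ring.
    rewrite E' -(prednK k0); apply: sos_cone_CsubX => //; apply: IH; first by rewrite prednK.
      by rewrite size_polyN; apply: szX E.
    move=> x hx; have := hp x hx; rewrite E' hornerM !hornerE pmulr_rge0 //.
    by move: hx => /andP[]; lra.
  (* Since [p] keeps its sign across an interior root, the cofactor is nonpositive on the left and
     nonnegative on the right: the root is at least double. *)
  have gz : g.[z] = 0.
    apply/le_anti/andP; split.
      rewrite -oppr_ge0 -hornerN; apply: (@horner_ge0_limit _ _ z (fun x => a < x < z)).
        by move=> d; apply: exists_near_left.
      move=> x /andP[ax xz]; have : 0 <= p.[x] by apply: hp; rewrite ax (lt_trans xz).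
      by rewrite E hornerM hornerXsubC hornerN; rewrite -mulrNN pmulr_rge0 //; lra.
    apply: (@horner_ge0_limit _ _ z (fun x => z < x < n%:R)).
      by move=> d; apply: exists_near_right.
    move=> x /andP[zx xn]; have : 0 <= p.[x] by apply: hp; rewrite xn (lt_trans az).
    by rewrite E hornerM hornerXsubC pmulr_rge0 //; lra.
  have /factor_theorem[g' E0] : root g z by apply/rootP.
  have {}E : p = ('X - z%:P) ^+ 2 * g' by rewrite E E0; ring.
  have hg' x : a < x < n%:R -> x != z -> 0 <= g'.[x].
    move=> hx xz; have := hp x hx; rewrite E hornerM horner_exp hornerXsubC.
    by rewrite pmulr_rge0 // exprn_even_gt0 //= subr_eq0.
  have hs := sz _ _ E; rewrite size_exp_XsubC in hs; have {}hs := hs isT.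
  rewrite E -(prednK k0) -add1n; apply: sos_coneM.
    by apply: cube_sos_sqr; rewrite size_XsubC.
  apply: IH; [by rewrite prednK|by apply: leq_trans hs _; lia|move=> x hx].
  have [->|] := eqVneq x z; last exact: hg'.
  apply: (@horner_ge0_limit _ _ z (fun x => z < x < n%:R)).
      by move=> d; apply: exists_near_right.
  by move=> y /andP[zy yn]; apply: hg'; [rewrite yn (lt_trans az)|rewrite gt_eqF].
have [x [y [y0 [g E]]]] := poly_quadratic_factor s1 nr.
have sQ : size (('X - x%:P) ^+ 2 + (y ^+ 2)%:P) = 3%N.
  rewrite size_polyDl ?size_exp_XsubC //.
  by rewrite size_polyC; case: eqP.
have hs := sz _ _ E; rewrite sQ in hs; have {}hs := hs isT.
rewrite E -(prednK k0) -add1n; apply: sos_coneM.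
  apply: cube_sosD; first by apply: cube_sos_sqr; rewrite size_XsubC.
  by apply: cube_sosC; rewrite sqr_ge0.
apply: IH; [by rewrite prednK|by apply: leq_trans hs _; lia|move=> t ht].
have := hp t ht; rewrite E hornerM pmulr_rge0 // !hornerE.
by rewrite ltr_wpDl ?sqr_ge0 // exprn_even_gt0.
Qed.

End Cone.

(** * Lagrange interpolation *)

Section Lagrange.
Variables (F : fieldType) (k : nat) (a : 'I_k -> F).
Hypothesis a_inj : injective a.

Definition lagrange_basis (i : 'I_k) : {poly F} :=
  \prod_(j < k | j != i) ((a i - a j)^-1 *: ('X - (a j)%:P)).

Lemma lagrange_basisE i j : (lagrange_basis i).[a j] = (i == j)%:R.
Proof.
rewrite horner_prod; have [<-|ij] := eqVneq i j.
  apply: big1 => t ti; rewrite hornerZ hornerXsubC mulVf //.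
  by rewrite subr_eq0 (inj_eq a_inj) eq_sym.
by rewrite (bigD1 j) 1?eq_sym //= hornerZ hornerXsubC subrr mulr0 mul0r.
Qed.

Lemma size_lagrange_basis i : (size (lagrange_basis i) <= k)%N.
Proof.
apply: leq_trans (size_poly_prod_leq _ _) _.
rewrite (eq_bigl (fun j => j \in predC1 i)) //.
have : (\sum_(j in predC1 i) size ((a i - a j)^-1 *: ('X - (a j)%:P)) <=
         \sum_(j in predC1 i) 2)%N.
  by apply: leq_sum => j _; rewrite (leq_trans (size_scale_leq _ _)) ?size_XsubC.
have : #|predC1 i| = k.-1 by rewrite cardC1 card_ord.
rewrite sum_nat_const => ->.
have := ltn_ord i; move: (\sum_(j in _) _)%N => S; lia.
Qed.

Lemma poly_factor_roots (p : {poly F}) : (forall i, p.[a i] = 0) ->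
  exists g, p = (\prod_(i < k) ('X - (a i)%:P)) * g.
Proof.
move=> hp.
have := @uniq_roots_dvdp F p (codom a).
rewrite big_map big_enum /= => /(_ _ _)/dvdpP[||g ->].
- by apply/allP => _ /codomP[i ->]; apply/rootP.
- by rewrite uniq_rootsE map_inj_uniq ?enum_uniq.
by exists g; rewrite mulrC.
Qed.

End Lagrange.

(** * Large q: a certificate of degree 2(n - m) *)

Section FullDegree.
Variables (R : realType) (n m : nat) (q : R).
Hypotheses (mn : (m < n)%N) (mq : m%:R < q) (qm : q < m.+1%:R).

Lemma ceil_between : Num.ceil q = m.+1%:Z.
Proof. by apply: ceil_def; rewrite -[m.+1]addn1 PoszD addrK mq -PoszD addn1 ltW. Qed.

Lemma mk_certificate_full : mk_certificate n q (2 * (n - m)).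
Proof.
set l := (n - m)%N.
have l0 : (0 < l)%N by rewrite subn_gt0.
have nE : (n%:R : R) = l%:R + m%:R by rewrite -natrD subnK // ltnW.
(* The nodes are m+1, ..., n, which are the roots of (n - X)_l. *)
pose a (i : 'I_l) : R := n%:R - i%:R.
have a_inj : injective a.
  move=> i j; rewrite /a => /addrI/oppr_inj/eqP; rewrite eqr_nat => /eqP.
  exact: val_inj.
(* The value a_i - (m+1) to interpolate, written as a natural number to make it visibly
   nonnegative. *)
pose w (i : 'I_l) : R := (l - i.+1)%:R.
have wE i : w i = a i - m.+1%:R.
  by rewrite /w /a nE natrB // -[m.+1]addn1 -[i.+1]addn1 !natrD; ring.
pose G : {poly R} := \sum_(i < l) w i *: (lagrange_basis a i) ^+ 2.
have hG : cube_sos n l.-1 G.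
  apply: cube_sos_sum => i _; apply: cube_sosZ; first exact: ler0n.
  by apply: cube_sos_sqr; rewrite prednK // size_lagrange_basis.
have Ga j : G.[a j] = a j - m.+1%:R.
  rewrite horner_sum (bigD1 j) //= big1 ?addr0 => [|i ij].
    by rewrite hornerZ horner_exp lagrange_basisE // eqxx expr1n mulr1 wE.
  by rewrite hornerZ horner_exp lagrange_basisE // (negPf ij) expr0n mulr0.
have sG : (size G <= (2 * l).-1)%N.
  rewrite /G; elim/big_ind: _ => [|x y hx hy|i _]; first by rewrite size_poly0.
    by rewrite (leq_trans (size_polyD _ _)) // geq_max hx.
  rewrite (leq_trans (size_scale_leq _ _)) // (leq_trans (size_poly_exp_leq _ _)) //.
  by have := size_lagrange_basis a i; move: (size _); lia.
pose N : {poly R} := 'X - (m.+1%:R)%:P - G.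
have sN : (size N <= maxn 2 (2 * l).-1)%N.
  rewrite (leq_trans (size_polyD _ _)) // size_polyN size_XsubC.
  by rewrite geq_max leq_maxl leq_max sG orbT.
have [g E] : exists g, N = (\prod_(i < l) ('X - (a i)%:P)) * g.
  by apply: poly_factor_roots => // i; rewrite !hornerE Ga subrr.
have cE : cffp R n l = (-1) ^+ l * \prod_(i < l) ('X - (a i)%:P).
  rewrite -[in (-1) ^+ l](card_ord l) -prodrN.
  by apply: eq_bigr => i _; rewrite opprB.
pose r := (-1) ^+ l * g.
have Er : N = cffp R n l * r.
  by rewrite cE /r mulrACA -exprMn mulrNN mulr1 expr1n mul1r.
have sr : (size r <= l)%N.
  have [->|r0] := eqVneq r 0; first by rewrite size_poly0.
  have sc : size (cffp R n l) = l.+1.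
    by rewrite cE size_Msign size_prod_XsubC /index_enum -enumT size_enum_ord.
  move: sN; rewrite Er size_mul // -?size_poly_eq0 sc // addSn /= => h.
  have : (maxn 2 (2 * l).-1 <= l + l)%N by rewrite geq_max; lia.
  by move: h; move: (maxn _ _) (size r); lia.
(* Then r = 2u + 1 = (u + 1)^2 - u^2. *)
pose u := 2^-1 *: (r - 1).
have rE : r = 2 * u + 1.
  have e2 : 2 = (2 : R)%:P :> {poly R} by rewrite polyC_natr.
  by rewrite /u -mul_polyC mulrA e2 -polyCM divff ?pnatr_eq0 // mul1r subrK.
have su : (size u <= l)%N.
  rewrite (leq_trans (size_scale_leq _ _)) // (leq_trans (size_polyD _ _)) //.
  by rewrite size_polyN size_poly1 geq_max sr.
(* Scaled so that h (m - q) = -u^2. In X - q = (X - m) + (m - q), the second summand yields the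
   negative square, and the first turns (n - X)_l into -(n - X)_(l+1). *)
pose h := (q - m%:R)^-1 *: u ^+ 2.
have q0 : 0 < q - m%:R by rewrite subr_gt0.
have hh : cube_sos n l.-1 h.
  by apply: cube_sosZ; [rewrite invr_ge0 ltW|apply: cube_sos_sqr; rewrite prednK].
apply: (@mk_certificate_cube_sos _ _ _ _
  (G + cffp R n l * (u + 1) ^+ 2 + cffp R n l.+1 * h) (cffp R n l * h)).
- apply: cube_sosD; first apply: cube_sosD.
  + by apply: cube_sosW hG; lia.
  + apply: (@cube_sosW _ _ (l + l.-1)); first by lia.
    apply: cube_sosM; first exact: cube_sos_cffp.
    apply: cube_sos_sqr; rewrite prednK // (leq_trans (size_polyD _ _)) //.
    by rewrite size_poly1 geq_max su.
  + apply: (@cube_sosW _ _ (l.+1 + l.-1)); first by lia.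
    by apply: cube_sosM => //; apply: cube_sos_cffp.
- apply: (@cube_sosW _ _ (l + l.-1)); first by lia.
  by apply: cube_sosM => //; apply: cube_sos_cffp.
have -> : cffp R n l.+1 = cffp R n l * ((m%:R)%:P - 'X).
  by rewrite /cffp big_ord_recr /= nE addrAC subrr add0r.
rewrite ceil_between.
have -> : 'X - (m.+1%:R)%:P = G + cffp R n l * (2 * u + 1) by rewrite -rE -Er /N; ring.
have hq : h * (m%:R - q)%:P = - u ^+ 2.
  rewrite /h -mul_polyC mulrAC -polyCM -[m%:R - q]opprB mulrN mulVf ?gt_eqF //.
  by rewrite polyCN polyC1 mulN1r.
transitivity (G + cffp R n l * (u + 1) ^+ 2 + cffp R n l * (h * (m%:R - q)%:P)).
  by rewrite hq; ring.
by rewrite polyCB; ring.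
Qed.

End FullDegree.

(** * Fejer kernels as damping factors *)

(* With y = sin^2 t this is the Fejer-type kernel sin^2 (2^r t) / (4^r sin^2 t). *)
Fixpoint fejer (F : fieldType) (c : F) (r : nat) : {poly F} :=
  if r is r'.+1 then
    fejer c r' * (1 - (4 ^+ r' * c)%:P * 'X * fejer c r')
  else 1.

Section Fejer.
Variables (R : realFieldType) (c : R).

Lemma fejer0 r : (fejer c r).[0] = 1.
Proof.
by elim: r => [|r IH] /=; rewrite ?hornerC // !hornerE IH; ring.
Qed.

Lemma size_fejer r : (size (fejer c r) <= 2 ^ r)%N.
Proof.
elim: r => [|r IH] /=; first by rewrite size_poly1.
have sXP : (size ((4 ^+ r * c)%:P * 'X * fejer c r)%R <= (2 ^ r).+1)%N.
  rewrite -mulrA mul_polyC (leq_trans (size_scale_leq _ _)) //.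
  by rewrite (leq_trans (size_polyMleq _ _)) // size_polyX.
have s1 : (size (1 - (4 ^+ r * c)%:P * 'X * fejer c r)%R <= (2 ^ r).+1)%N.
  by rewrite (leq_trans (size_polyD _ _)) // size_polyN size_poly1 geq_max sXP.
apply: leq_trans (size_polyMleq _ _) _.
by rewrite expnS; move: IH s1; move: (size _) (size _) (2 ^ r)%N; lia.
Qed.

Variable x : R.
Hypotheses (x0 : 0 <= c * x) (x1 : c * x <= 1).

Lemma hornerS_fejer r : let P := (fejer c r).[x] in
  (fejer c r.+1).[x] = P * (1 - 4 ^+ r * (c * x) * P).
Proof. by rewrite /= hornerM hornerD hornerN !hornerM !hornerC hornerX; ring. Qed.

(* w = 4^r c x P_r follows the logistic map w |-> 4 w (1 - w). *)
Lemma fejer_itv r : let P := (fejer c r).[x] in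
  [/\ 0 <= P, P <= 1 & 4 ^+ r * (c * x) * P <= 1].
Proof.
elim: r => [|r [P0 P1 w1]]; first by rewrite /= hornerC expr0 mul1r mulr1.
rewrite /= hornerS_fejer; set P := (fejer c r).[x] in P0 P1 w1 *.
set w := 4 ^+ r * (c * x) * P in w1 *.
have w0 : 0 <= w by apply: mulr_ge0 => //; apply: mulr_ge0 => //; apply: exprn_ge0.
have -> : 4 ^+ r.+1 * (c * x) * (P * (1 - w)) = 4 * w * (1 - w) by rewrite /w exprS; ring.
clearbody w; split; [by rewrite mulr_ge0 // subr_ge0| |].
  by rewrite mulr_ile1 // ?subr_ge0 // lerBlDr lerDl.
have -> : 4 * w * (1 - w) = 1 - (2 * w - 1) ^+ 2 by ring.
by rewrite gerBl sqr_ge0.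
Qed.

(** With w = 4^r c x P the left side is (1 - w)(P + w), at most 1 - w^2 because P <= 1. *)
Lemma fejer_decay r : (fejer c r.+1).[x] * (1 + 4 ^+ r * (c * x)) <= 1.
Proof.
have [P0 P1 w1] := fejer_itv r.
rewrite hornerS_fejer; set P := (fejer c r).[x] in P0 P1 w1 *.
set w := 4 ^+ r * (c * x) * P in w1 *.
have w0 : 0 <= w by apply: mulr_ge0 => //; apply: mulr_ge0 => //; apply: exprn_ge0.
have -> : P * (1 - w) * (1 + 4 ^+ r * (c * x)) = (1 - w) * (P + w) by rewrite /w; ring.
clearbody w; nra.
Qed.

End Fejer.

(** The least r with n <= l 4^r overshoots by at most a factor 4. *)
Lemma exists_pow4_between l n : (0 < l <= n)%N ->
  exists r, (n <= l * 4 ^ r <= 4 * n)%N.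
Proof.
case/andP=> l0 ln.
have ex : exists r, (n <= l * 4 ^ r)%N.
  by exists n; rewrite (leq_trans (ltnW (ltn_expl n (isT : (1 < 4)%N)))) // leq_pmull.
exists (ex_minn ex); case: ex_minnP => -[|r] h hmin; rewrite h /=.
  by rewrite muln1 (leq_trans ln) // leq_pmull.
rewrite expnS mulnCA leq_pmul2l // leqNgt; apply/negP => /ltnW/hmin.
by rewrite ltnn.
Qed.

(* Powers of 1 - x/n would need degree of order n / l instead of sqrt (n / l). *)
Lemma exists_damping (R : realFieldType) l n : (0 < l <= n)%N ->
  exists D : {poly R}, [/\ D.[0] = 1, (size D ^ 2 * l <= 16 * n)%N &
    forall x, 0 <= x <= n%:R -> 0 <= D.[x] /\ D.[x] * (l%:R + x) <= l%:R].
Proof.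
move=> ln; have [r /andP[nr rn]] := exists_pow4_between ln.
case/andP: ln => l0 ln; have n0 := leq_trans l0 ln.
have nR0 : 0 < n%:R :> R by rewrite ltr0n.
exists (fejer (n%:R^-1) r.+1); split; first exact: fejer0.
  apply: (@leq_trans ((2 ^ r.+1) ^ 2 * l)).
    by rewrite leq_mul2r leq_exp2r // size_fejer orbT.
  have -> : ((2 ^ r.+1) ^ 2 = 4 * 4 ^ r)%N by rewrite -expnM mulnC expnM expnS.
  by rewrite -mulnA [(4 ^ r * l)%N]mulnC (_ : 16 = 4 * 4)%N // -mulnA leq_mul2l.
move=> x /andP[x0 xn].
have cx0 : 0 <= n%:R^-1 * x by rewrite mulr_ge0 // invr_ge0 ltW.
have cx1 : n%:R^-1 * x <= 1 by rewrite ler_pdivrMl ?mulr1.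
have [D0 _ _] := fejer_itv cx0 cx1 r.+1; split=> //.
have := fejer_decay cx0 cx1 r; move: D0; set D := _.[x] => D0.
have l1 : 0 < l%:R :> R by rewrite ltr0n.
move=> h; apply: le_trans (_ : l%:R * (D * (1 + 4 ^+ r * (n%:R^-1 * x))) <= _); last first.
  by rewrite ler_piMr // ltW.
rewrite [l%:R * _]mulrCA ler_wpM2l // mulrDr mulr1 lerD2l.
have -> : l%:R * (4 ^+ r * (n%:R^-1 * x)) = l%:R * 4 ^+ r / n%:R * x by ring.
rewrite -[leLHS]mul1r ler_wpM2r // ler_pdivlMr // mul1r.
by rewrite -natrX -natrM ler_nat.
Qed.

(** * Sums of inverse square roots *)

Section InvSqrtSum.
Variable R : rcfType.

(** The difference of roots is 1/(sqrt(l+1) + sqrt l), and sqrt(l+1) <= 2 sqrt l when l >= 1. At l =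
    0 the inverse is 0 by convention. *)
Lemma invsqrt_le_diff (l : nat) :
  (Num.sqrt l%:R)^-1 <= 3 * (Num.sqrt l.+1%:R - Num.sqrt l%:R) :> R.
Proof.
case: l => [|l]; first by rewrite sqrtr0 invr0 subr0 mulr_ge0 // sqrtr_ge0.
set s := Num.sqrt l.+1%:R; set t := Num.sqrt l.+2%:R.
have s0 : 0 < s by rewrite sqrtr_gt0 ltr0n.
have st : s <= t by rewrite ler_wsqrtr // ler_nat.
have s2 : s ^+ 2 = l.+1%:R by rewrite sqr_sqrtr ?ler0n.
have t2 : t ^+ 2 = l.+1%:R + 1 by rewrite sqr_sqrtr ?ler0n // natr1.
have l1 : 1 <= l.+1%:R :> R by rewrite ler1n.
have t2s : t <= 2 * s.
  have t0 : 0 < t := lt_le_trans s0 st.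
  by rewrite -(@ler_pXn2r _ 2) ?nnegrE ?mulr_ge0 ?ltW //; lra.
rewrite -[leLHS]mul1r ler_pdivrMr //.
have : (t - s) * (t + s) = 1 by rewrite -subr_sqr t2 s2; ring.
clearbody s t; nra.
Qed.

(** Terms with j <= i are inverses of zero, hence 0; the bounds on the others telescope. *)
Lemma sum_invsqrt_right (i K : nat) :
  \sum_(j < K) (Num.sqrt (j - i)%:R)^-1 <= 3 * Num.sqrt K%:R :> R.
Proof.
have H : \sum_(j < K) (Num.sqrt (j - i)%:R)^-1 <= 3 * Num.sqrt (K - i)%:R :> R.
  elim: K => [|K IH]; first by rewrite big_ord0 sub0n sqrtr0 mulr0.
  rewrite big_ord_recr /=; have [iK|Ki] := leqP i K.
    apply: le_trans (lerD IH (invsqrt_le_diff _)) _.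
    by rewrite -mulrDr addrC subrK subSn.
  have /eqP E0 : (K - i == 0)%N by rewrite subn_eq0 ltnW.
  move: IH; rewrite E0 sqrtr0 mulr0 invr0 addr0 => IH.
  by apply: le_trans IH _; rewrite mulr_ge0 // sqrtr_ge0.
by apply: le_trans H _; rewrite ler_pM2l // ler_wsqrtr // ler_nat leq_subr.
Qed.

Lemma sum_invsqrt_left (i K : nat) :
  \sum_(j < K) (Num.sqrt (i - j)%:R)^-1 <= 3 * Num.sqrt i.+1%:R :> R.
Proof.
suff H : \sum_(j < K) (Num.sqrt (i - j)%:R)^-1 <=
    3 * (Num.sqrt i.+1%:R - Num.sqrt (i.+1 - K)%:R) :> R.
  by apply: le_trans H _; rewrite ler_pM2l // gerBl sqrtr_ge0.
elim: K => [|K IH]; first by rewrite big_ord0 subn0 subrr mulr0.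
rewrite big_ord_recr /= subSS.
have h : (Num.sqrt (i - K)%:R)^-1 <=
    3 * (Num.sqrt (i.+1 - K)%:R - Num.sqrt (i - K)%:R) :> R.
  have [Ki|iK] := leqP K i; first by rewrite subSn // invsqrt_le_diff.
  rewrite (_ : i - K = 0)%N; last by apply/eqP; rewrite subn_eq0 ltnW.
  by rewrite sqrtr0 invr0 subr0 mulr_ge0 // sqrtr_ge0.
by apply: le_trans (lerD IH h) _; rewrite -mulrDr; set s := Num.sqrt _; lra.
Qed.

End InvSqrtSum.

(** * Damped Lagrange polynomials *)

Section LocalizedBasis.
Variables (R : realType) (n K b : nat).
Hypothesis Kn : (K <= n)%N.

(* Lagrange basis at the nodes 0..K-1, each factor x - j damped at distance
   |i - j| so that the product stays bounded beyond the nodes. *)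
Lemma exists_localized_basis (i : 'I_K) : (i.+1 < K)%N ->
  exists u : {poly R}, [/\ forall j : 'I_K, u.[j%:R] = (i == j)%:R,
    forall x, K%:R <= x <= n%:R -> u.[x] ^+ 2 <= 9^-1 ^+ b &
    (size u)%:R <= 1 + 24 * Num.sqrt (n%:R * K%:R) + 4 * b%:R * Num.sqrt n%:R :> R].
Proof.
move=> iK.
have n0 : (0 < n)%N by rewrite (leq_trans _ Kn) // (leq_trans _ iK).
have /boolp.choice[D hD] : forall l, exists D : {poly R}, (0 < l <= n)%N ->
    [/\ D.[0] = 1, (size D ^ 2 * l <= 16 * n)%N &
    forall x, 0 <= x <= n%:R -> 0 <= D.[x] /\ D.[x] * (l%:R + x) <= l%:R].
  move=> l; have [/(exists_damping R)[D ?]|] := boolP (0 < l <= n)%N; first by exists D.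
  by exists 0.
pose dist (j : 'I_K) := ((i - j) + (j - i))%N.
have dist_itv j : j != i -> (0 < dist j <= n)%N.
  move=> ji; have := ltn_ord i; have := ltn_ord j; rewrite /dist.
  have : nat_of_ord j != i by [].
  move: (nat_of_ord j) (nat_of_ord i) => u v; lia.
have distE j : (dist j)%:R = `|i%:R - j%:R| :> R.
  rewrite /dist; have [ij|ji] := leqP i j.
    rewrite (_ : i - j = 0)%N; last by apply/eqP.
    by rewrite add0n natrB // distrC ger0_norm // subr_ge0 ler_nat.
  rewrite (_ : j - i = 0)%N; last by apply/eqP; rewrite subn_eq0 ltnW.
  by rewrite addn0 (natrB _ (ltnW ji)) ger0_norm // subr_ge0 ler_nat (ltnW ji).
have szD l : (0 < l <= n)%N -> (size (D l))%:R <= 4 * Num.sqrt n%:R * (Num.sqrt l%:R)^-1 :> R.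
  move=> hl; have [_ h _] := hD l hl; case/andP: hl => l0 _.
  rewrite ler_pdivlMr ?sqrtr_gt0 ?ltr0n //.
  rewrite -(@ler_pXn2r _ 2) ?nnegrE ?mulr_ge0 ?sqrtr_ge0 //.
  rewrite !exprMn !sqr_sqrtr // (_ : 4 ^+ 2 = 16%:R); last by ring.
  by rewrite -natrX -!natrM ler_nat.
pose sh (p : {poly R}) := p \Po ('X - (i%:R)%:P).
have shE p x : (sh p).[x] = p.[x - i%:R] by rewrite horner_comp hornerXsubC.
have szsh p : size (sh p) = size p by rewrite size_comp_poly2 // size_XsubC.
pose V (j : 'I_K) : {poly R} := ((i%:R - j%:R)^-1 *: ('X - (j%:R)%:P)) * sh (D (dist j)).
(* Every shifted kernel equals 1 at i, so the interpolation conditions survive; the [b] extra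
   kernels give the geometric decay. *)
exists ((\prod_(j < K | j != i) V j) * sh (D 1) ^+ b).
have h1 : (0 < 1 <= n)%N by [].
split.
- move=> j; rewrite hornerM horner_exp horner_prod shE.
  have [<-|ij] := eqVneq i j.
    rewrite subrr; have [-> _ _] := hD 1 h1; rewrite expr1n mulr1.
    apply: big1 => t ti; rewrite hornerM shE subrr hornerZ hornerXsubC.
    have [-> _ _] := hD _ (dist_itv _ ti); rewrite mulr1 mulVf //.
    by rewrite subr_eq0 eqr_nat eq_sym.
  by rewrite (bigD1 j) 1?eq_sym //= hornerM hornerZ hornerXsubC subrr mulr0 !mul0r.
- move=> x /andP[Kx xn].
  (* This is where i + 1 < K matters: at distance at least 2 the kernel for l = 1 is at most 1/3. *)
  have xi2 : 2 <= x - i%:R.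
    have : i.+2%:R <= K%:R :> R by rewrite ler_nat.
    by rewrite -addn2 natrD; lra.
  have hx : 0 <= x - i%:R <= n%:R.
    have : 0 <= i%:R :> R by rewrite ler0n.
    by move=> i0; apply/andP; split; lra.
  have [_ _ /(_ _ hx)[G0 G1]] := hD 1 h1.
  have G3 : (D 1).[x - i%:R] <= 3^-1 by move: G0 G1; set G := (D 1).[_]; nra.
  rewrite hornerM horner_exp horner_prod shE exprMn -[_ ^+ b ^+ 2]exprM mulnC exprM.
  rewrite -[leRHS]mul1r; apply: ler_pM; rewrite ?sqr_ge0 ?exprn_ge0 ?sqr_ge0 //; last first.
    apply: lerXn2r; rewrite ?nnegrE ?sqr_ge0 ?invr_ge0 //.
    rewrite (_ : 9^-1 = 3^-1 ^+ 2 :> R); last by field.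
    by rewrite lerXn2r ?nnegrE ?invr_ge0.
  rewrite -real_normK ?num_real // normr_prod exprn_ile1 ?prodr_ge0 //.
  apply: prodr_ile1 => j ji; rewrite normr_ge0 /= /V hornerM hornerZ hornerXsubC shE.
  have [_ _ /(_ _ hx)[d0 d1]] := hD _ (dist_itv _ ji).
  have dp : 0 < (dist j)%:R :> R by rewrite ltr0n; case/andP: (dist_itv _ ji).
  rewrite !normrM normfV -distE (ger0_norm d0) -mulrA ler_pdivrMl // mulr1.
  apply: le_trans d1; rewrite mulrC ler_wpM2l //.
  (* The triangle inequality |x - j| <= |i - j| + (x - i) matches the decay l / (l + x - i) of the
     kernel with l = |i - j|. *)
  have -> : x - j%:R = (i%:R - j%:R) + (x - i%:R) by ring.
  apply: le_trans (ler_normD _ _) _; rewrite distE lerD2l ger0_norm //.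
  by case/andP: hx.
have szu : (size ((\prod_(j < K | j != i) V j) * sh (D 1%N) ^+ b)%R <=
    1 + \sum_(j < K | j != i) size (D (dist j)) + b * size (D 1))%N.
  apply: leq_trans (size_polyMleq _ _) _.
  have e1 : (size (\prod_(j < K | j != i) V j)%R <=
      1 + \sum_(j < K | j != i) size (D (dist j)))%N.
    apply: leq_trans (size_poly_prod_leq _ _) _.
    have : (\sum_(j < K | j != i) size (V j) <=
        \sum_(j < K | j != i) (1 + size (D (dist j))))%N.
      apply: leq_sum => j _; apply: leq_trans (size_polyMleq _ _) _.
      rewrite szsh; have : (size ((i%:R - j%:R : R)^-1 *: ('X - (j%:R)%:P))%R <= 2)%N.
        by rewrite (leq_trans (size_scale_leq _ _)) // size_XsubC.
      by move: (size _) (size _); lia.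
    rewrite big_split /= sum1_card.
    have -> : #|[pred j | j != i]| = #|(fun j => j != i)| by [].
    by move: (\sum_(j < K | _) _)%N (\sum_(j < K | _) _)%N #|_|; lia.
  have e2 : (size (sh (D 1%N) ^+ b)%R <= 1 + b * size (D 1%N))%N.
    apply: leq_trans (size_poly_exp_leq _ _) _; rewrite szsh mulnC.
    by rewrite add1n ltnS leq_mul2l leq_pred orbT.
  by move: e1 e2; move: (size _) (size (sh _ ^+ _)) (\sum_(j < K | _) _)%N (b * _)%N; lia.
apply: le_trans (_ : (1 + \sum_(j < K | j != i) size (D (dist j)) + b * size (D 1))%:R <= _).
  by rewrite ler_nat.
rewrite !natrD natrM natr_sum; apply: lerD; first (rewrite lerD2l).
  (* Truncated subtraction makes at least one of the two inverse roots 0, so the sum splits into the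
     nodes left and right of i. Each side is at most 3 sqrt K, whence 24 = 4 (3 + 3). *)
  apply: le_trans (_ : \sum_(j < K) 4 * Num.sqrt n%:R *
      ((Num.sqrt (i - j)%:R)^-1 + (Num.sqrt (j - i)%:R)^-1) <= _).
    rewrite big_mkcond /=; apply: ler_sum => j _.
    have [_|ji] := eqVneq j i.
      by rewrite mulr_ge0 ?mulr_ge0 ?addr_ge0 ?invr_ge0 ?sqrtr_ge0.
    apply: le_trans (szD _ (dist_itv _ ji)) _.
    rewrite ler_wpM2l ?mulr_ge0 ?sqrtr_ge0 // /dist.
    have [ij|ij] := leqP i j.
      by rewrite (_ : i - j = 0)%N ?add0n ?sqrtr0 ?invr0 ?add0r //; apply/eqP.
    rewrite (_ : j - i = 0)%N ?addn0 ?sqrtr0 ?invr0 ?addr0 //.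
    by apply/eqP; rewrite subn_eq0 ltnW.
  rewrite -mulr_sumr big_split /= sqrtrM ?ler0n //.
  have -> : 24 * (Num.sqrt n%:R * Num.sqrt K%:R) =
    4 * Num.sqrt n%:R * (3 * Num.sqrt K%:R + 3 * Num.sqrt K%:R) :> R by ring.
  rewrite ler_wpM2l ?mulr_ge0 ?sqrtr_ge0 // lerD ?sum_invsqrt_right //.
  apply: le_trans (sum_invsqrt_left _ _ _) _.
  by rewrite ler_pM2l // ler_wsqrtr // ler_nat.
have := szD 1 h1; rewrite sqrtr1 invr1 mulr1 => h.
by rewrite [4 * _]mulrC -mulrA ler_wpM2l.
Qed.

End LocalizedBasis.

(** * Small q: a certificate from damped interpolation *)

Section Damped.
Variables (R : realType) (n m b : nat) (q : R).
Local Notation K := m.+2.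
Hypotheses (mq : m%:R < q) (qm : q < m.+1%:R) (Kn : (K < n)%N).
Hypothesis hb : 2 * K%:R <= (q - m%:R) * 9 ^+ b.

Let bound : R := 24 * Num.sqrt (n%:R * K%:R) + 4 * b%:R * Num.sqrt n%:R.
Let U := Num.truncn bound.

Let bound_ge0 : 0 <= bound.
Proof. by rewrite addr_ge0 ?mulr_ge0 ?sqrtr_ge0 ?ler0n. Qed.

Lemma mk_certificate_damped : mk_certificate n q (K + 2 * U).
Proof.
have /boolp.choice[u hu] : forall i : 'I_K, exists u : {poly R}, (i.+1 < K)%N ->
    [/\ forall j : 'I_K, u.[j%:R] = (i == j)%:R,
      forall x, K%:R <= x <= n%:R -> u.[x] ^+ 2 <= 9^-1 ^+ b &
      (size u)%:R <= 1 + 24 * Num.sqrt (n%:R * K%:R) + 4 * b%:R * Num.sqrt n%:R :> R].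
  move=> i; have [h|] := boolP (i.+1 < K)%N; last by exists 0.
  by have [u hu] := exists_localized_basis R b (ltnW Kn) h; exists u.
(* The value forced by s1(i) (i - q) = i - (m+1). It is 0 at the last node m+1, which therefore gets
   no summand in [s1]. *)
pose c (i : 'I_K) : R := (m.+1%:R - i%:R) / (q - i%:R).
have im (i : 'I_K) : (i.+1 < K)%N -> (i%:R : R) <= m%:R by rewrite !ltnS ler_nat.
have qh0 : 0 < q - m%:R by rewrite subr_gt0.
have m1E : (m.+1%:R : R) = m%:R + 1 by rewrite natr1.
have KE : (K%:R : R) = m%:R + 2 by rewrite -[K]addn2 natrD.
have c0 (i : 'I_K) : (i.+1 < K)%N -> 0 <= c i.
  by move=> /im h; rewrite divr_ge0 //; lra.
have c1 (i : 'I_K) : (i.+1 < K)%N -> c i <= (q - m%:R)^-1.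
  move=> /im h; rewrite /c ler_pdivrMr; last by lra.
  by rewrite ler_pdivlMl //; move: qm; rewrite m1E => qm'; nra.
have szu (i : 'I_K) : (i.+1 < K)%N -> (size (u i) <= U.+1)%N.
  move=> h; have [_ _ hs] := hu i h.
  case: (size (u i)) hs => // s; rewrite ltnS /U truncn_ge_nat // -natr1 /bound.
  by move=> hs; lra.
pose s1 : {poly R} := \sum_(i < K | (i.+1 < K)%N) c i *: (u i) ^+ 2.
have hs1 : cube_sos n U s1.
  apply: cube_sos_sum => i h; apply: cube_sosZ; first exact: c0.
  exact/cube_sos_sqr/szu.
have s1n (j : 'I_K) : s1.[j%:R] * (j%:R - q) = j%:R - m.+1%:R.
  rewrite horner_sum.
  have term (i : 'I_K) : (i.+1 < K)%N -> (c i *: (u i) ^+ 2).[j%:R] = c i * (i == j)%:R.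
    move=> /hu[h _ _]; rewrite hornerZ horner_exp h.
    by case: (i == j); rewrite ?expr1n ?expr0n.
  rewrite (eq_bigr _ term); have [jK|] := boolP (j.+1 < K)%N; last first.
    rewrite -leqNgt ltnS => jK; have jE : nat_of_ord j = m.+1.
      by apply/eqP; rewrite eqn_leq jK andbT -ltnS ltn_ord.
    rewrite big1 ?mul0r ?jE ?subrr // => i iK.
    by have [ij|] := eqVneq i j; [move: iK; rewrite ij jE ltnn|rewrite mulr0].
  rewrite (bigD1 j) //= big1 ?addr0 => [|i /andP[_ /negPf->]]; last by rewrite mulr0.
  rewrite eqxx mulr1 /c -[j%:R - q]opprB mulrN mulfVK ?opprB //.
  by rewrite gt_eqF //; move: (im j jK); lra.
(* Each of at most K terms is bounded by 9^-b / (q - m), and [hb] makes the total at most 1/2. *)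
have s1x x : K%:R <= x <= n%:R -> s1.[x] <= 2^-1.
  move=> hx; rewrite horner_sum.
  apply: le_trans (_ : \sum_(i < K) (q - m%:R)^-1 * 9^-1 ^+ b <= _).
    rewrite big_mkcond /=; apply: ler_sum => i _; case: ifP => h; last first.
      by rewrite mulr_ge0 ?exprn_ge0 ?invr_ge0 // ltW.
    have [_ /(_ x hx) ux _] := hu i h.
    rewrite hornerZ horner_exp; apply: ler_pM => //; [exact: c0|exact: sqr_ge0|exact: c1].
  rewrite sumr_const card_ord -[leLHS]mulr_natr exprVn -invfM.
  rewrite ler_pdivrMl ?mulr_gt0 ?exprn_gt0 //.
  by rewrite ler_pdivlMr // mulrC.
pose f : {poly R} := 'X - (m.+1%:R)%:P - s1 * ('X - q%:P).
have [e Ef] : exists e, f = ffp R K * e.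
  apply: (@poly_factor_roots _ _ (fun i : 'I_K => i%:R : R)).
    by move=> i j /eqP; rewrite eqr_nat => /eqP/val_inj.
  by move=> i; rewrite /f !hornerE s1n subrr.
have ss1 : (size s1 <= (2 * U).+1)%N.
  rewrite /s1; elim/big_ind: _ => [|x y hx hy|i h]; first by rewrite size_poly0.
    by rewrite (leq_trans (size_polyD _ _)) // geq_max hx.
  rewrite (leq_trans (size_scale_leq _ _)) // (leq_trans (size_poly_exp_leq _ _)) //.
  by have := szu i h; move: (size _); lia.
have sf : (size f <= (2 * U).+2)%N.
  rewrite (leq_trans (size_polyD _ _)) // size_polyN size_XsubC geq_max /=.
  apply: leq_trans (size_polyMleq _ _) _; rewrite size_XsubC.
  by move: ss1; move: (size _); lia.
have se : (size e <= (2 * U).+1)%N.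
  have [->|e0] := eqVneq e 0; first by rewrite size_poly0.
  have sc : size (ffp R K) = K.+1.
    by rewrite /ffp size_prod_XsubC /index_enum -enumT size_enum_ord.
  have fp0 : ffp R K != 0 by rewrite -size_poly_eq0 sc.
  by move: sf; rewrite Ef size_mul // sc; move: (size e); lia.
have KnR : K%:R < n%:R :> R by rewrite ltr_nat.
have [A [B [hA hB eE]]] : sos_cone n K%:R (2 * U) e.
  apply: sos_cone_ge0 => // x /andP[Kx xn].
  have xI : K%:R <= x <= n%:R by rewrite !ltW.
  have fx : 0 <= f.[x].
    rewrite /f !hornerE subr_ge0; move: (s1x x xI) => h1.
    (* From x >= m+2 and q > m follows (x - q)/2 <= x - (m+1). *)
    apply: le_trans (_ : 2^-1 * (x - q) <= _); last by lra.
    by rewrite ler_wpM2r //; move: qm; lra.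
  move: fx; rewrite Ef hornerM pmulr_rge0 // horner_prod prodr_gt0 // => i _.
  by rewrite hornerXsubC subr_gt0 (le_lt_trans _ Kx) // ler_nat ltnW.
(* The factor X - K allowed by the cone extends (X)_K to (X)_(K+1). *)
have fE : f = ffp R K * A + ffp R K.+1 * B.
  by rewrite Ef eE /ffp [in X in _ = _ + X]big_ord_recr /=; ring.
apply: (@mk_certificate_cube_sos _ _ _ _ f s1).
- rewrite fE; apply: cube_sosD.
    apply: (@cube_sosW _ _ (K + 2 * U)); first by lia.
    by apply: cube_sosM => //; apply: cube_sos_ffp.
  apply: (@cube_sosW _ _ (K.+1 + 2 * U)); first by lia.
  by apply: cube_sosM => //; apply: cube_sos_ffp.
- by apply: cube_sosW hs1; lia.
by rewrite (ceil_between mq qm) /f subrK.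
Qed.


End Damped.

(** * Degree estimate and conclusion *)

Lemma ltn_half_addn2 m n : (m < n./2 -> 2 < n -> m.+2 < n)%N.
Proof.
rewrite geq_half_double -addnn; case: m => // m; lia.
Qed.

(** Taking [b] just above the base-2 logarithm of 2(m+2)/h suffices, since 2 <= 9. The factor ln 2
    in the conclusion clears the denominator of that logarithm. *)
Lemma damped_degree_le (R : realType) (n m : nat) (h : R) :
  (m.+2 < n)%N -> 0 < h -> h <= 1 ->
  exists2 b, 2 * m.+2%:R <= h * 9 ^+ b &
    ln 2 * (m.+2 + 2 * Num.truncn
      (24 * Num.sqrt (n%:R * m.+2%:R) + 4 * b%:R * Num.sqrt n%:R : R))%:R <=
    200 * (Num.sqrt n%:R * ln (2 / h) + Num.sqrt (n%:R * m%:R) * ln n%:R) :> R.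
Proof.
move=> Kn h0 h1; set l := ln 2; set L := ln (2 / h); set M : R := ln m.+2%:R.
have l0 : 0 < l by rewrite ln_gt0 // ltr1n.
have lL : l <= L.
  by rewrite ler_ln ?posrE ?divr_gt0 // ler_pdivlMr // ler_piMr.
have lM : l <= M by rewrite ler_ln ?posrE ?ltr0n // ler_nat.
have LME : ln (2 * m.+2%:R / h) = M + L.
  by rewrite mulrAC lnM ?posrE ?divr_gt0 ?ltr0n // addrC.
pose b := (Num.truncn ((M + L) / l)).+1.
have ML0 : 0 <= (M + L) / l by rewrite divr_ge0 // ?addr_ge0 // ltW // (lt_le_trans l0).
have bl : b%:R * l <= l + M + L.
  have : (Num.truncn ((M + L) / l))%:R <= (M + L) / l by rewrite truncn_le.
  rewrite ler_pdivlMr // => hb.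
  by have -> : b%:R = (Num.truncn ((M + L) / l))%:R + 1 :> R;
    [rewrite natr1|rewrite mulrDl mul1r; lra].
have lb : M + L <= b%:R * l.
  have /andP[_ /ltW] := truncn_itv ML0.
  by rewrite ler_pdivrMr.
exists b.
  apply: le_trans (_ : h * 2 ^+ b <= _); last first.
    by rewrite ler_pM2l // lerXn2r ?nnegrE ?ler_nat.
  rewrite -ler_pdivrMl // mulrC -ler_ln ?posrE ?divr_gt0 ?mulr_gt0 ?ltr0n ?exprn_gt0 //.
  by rewrite LME lnXn // -[leRHS]mulr_natl.
rewrite !sqrtrM ?ler0n //.
set s := Num.sqrt n%:R; set k := Num.sqrt m.+2%:R; set t := Num.sqrt m%:R; set N := ln n%:R.
have s0 : 0 <= s by rewrite sqrtr_ge0.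
have t0 : 0 <= t by rewrite sqrtr_ge0.
have k0 : 0 <= k by rewrite sqrtr_ge0.
have ks : k <= s by rewrite ler_wsqrtr // ler_nat ltnW.
have k2 : k ^+ 2 = m.+2%:R by rewrite sqr_sqrtr ?ler0n.
have t2 : t ^+ 2 = m%:R by rewrite sqr_sqrtr ?ler0n.
have kt : k <= 2 + t.
  rewrite -(@ler_pXn2r _ 2) ?nnegrE ?addr_ge0 // k2 sqrrD t2 -addn2 natrD.
  lra.
have MN : M <= N by rewrite ler_ln ?posrE ?ltr0n ?ler_nat // ltnW // (leq_trans _ Kn).
set U := Num.truncn _.
have hU : U%:R <= 24 * (s * k) + 4 * b%:R * s.
  by rewrite truncn_le addr_ge0 ?mulr_ge0.
(* For m = 0, ln(m+2) is ln 2 and is absorbed by ln(2/h); for m >= 1, sqrt m >= 1 lets the second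
   term absorb it. *)
have sM : s * M <= s * L + s * t * N.
  rewrite -mulrA -mulrDr ler_wpM2l //.
  case: (m) @M @t lM MN t0 {t2 kt LME ML0 b bl lb hU U} => [|m'] M t lM MN t0.
    rewrite (_ : M = l) // .
    by apply: le_trans lL _; rewrite lerDl mulr_ge0 // (le_trans _ MN) // (le_trans _ lM) // ltW.
  have t1 : 1 <= t by rewrite -sqrtr1 ler_wsqrtr // ler1n.
  have N0 : 0 <= N by rewrite (le_trans _ MN) // (le_trans _ lM) // ltW.
  have L0 : 0 <= L by rewrite ltW // (lt_le_trans l0).
  have tN : N <= t * N by rewrite ler_peMl.
  by rewrite (le_trans MN) // (le_trans tN) // lerDr.
rewrite natrD natrM.
have e1 : m.+2%:R <= s * k by rewrite -k2 expr2 ler_wpM2r.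
have e2 : l * (s * k) <= 2 * (s * L) + s * t * N.
  apply: le_trans (_ : l * (s * (2 + t)) <= _); first by rewrite !ler_wpM2l // ltW.
  have : s * l <= s * L by rewrite ler_wpM2l.
  have : s * t * l <= s * t * N by rewrite ler_wpM2l ?mulr_ge0 // (le_trans lM).
  by lra.
have e3 : s * (b%:R * l) <= s * (l + M + L) by rewrite ler_wpM2l.
have e4 : s * l <= s * L by rewrite ler_wpM2l.
have e5 : 0 <= s * t * N by rewrite !mulr_ge0 // (le_trans _ MN) // (le_trans _ lM) // ltW.
have e6 : 0 <= s * L by rewrite mulr_ge0 // (le_trans (ltW l0)).
(* Here 49 = 2 * 24 + 1, the extra unit coming from [e1]. The collected bounds give at most 122 s L
   + 57 s t N, within the constant 200. *)
have : l * (m.+2%:R + 2 * U%:R) <= l * (49 * (s * k) + 8 * b%:R * s).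
  by rewrite ler_pM2l //; lra.
lra.
Qed.

Theorem theorem1p2 (R : realType) :
  exists2 C : R, 0 < C &
    forall (n : nat) (q : R),
      (1 <= n)%N -> 0 < q -> q < n%:R ->
      q - (Num.floor q)%:~R != 0 ->
      exists d : nat,
        [/\ is_sos_rank n q d,
            q < (n./2)%:R ->
              d%:R <= C * (Num.sqrt n%:R * ln (2 / (q - (Num.floor q)%:~R)) +
                           Num.sqrt (n%:R * (Num.floor q)%:~R) * ln n%:R)
          & (n./2)%:R < q ->
              d%:R <= C * (n%:R - (Num.floor q)%:~R)].
Proof.
have l0 : 0 < ln 2 :> R by rewrite ln_gt0 // ltr1n.
(* The first summand serves small q; the 2 is the factor in the degree 2(n - m) for large q. *)
exists (200 / ln 2 + 2); first by rewrite addr_gt0 // divr_gt0.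
move=> n q n1 q0 qn; have := floor_itv q.
have : (0 <= Num.floor q)%R by rewrite floor_ge0 ltW.
case: (Num.floor q) => // m _; rewrite -[(m%:Z + 1)%R]PoszD addn1 -!pmulrn => /andP[mq qm] qm0.
have {}mq : m%:R < q by rewrite lt_neqAle mq eq_sym -subr_eq0 qm0.
have mn : (m < n)%N by rewrite -(ltr_nat R) (lt_trans mq).
have full := mk_certificate_full mn mq qm.
(* Reflecting certificates into booleans gives access to the least degree; the full-degree
   certificate shows that some degree works. *)
have ex : exists d, boolp.asbool (mk_certificate n q d)
  by exists (2 * (n - m))%N; apply/boolp.asboolP.
case: (ex_minnP ex) => d /boolp.asboolP hd dmin.
have dle d' : mk_certificate n q d' -> (d <= d')%N by move=> h; apply/dmin/boolp.asboolP.
exists d; split=> //.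
- move=> q2.
  set A := Num.sqrt n%:R * _; set B := Num.sqrt _ * _.
  have qh1 : q - m%:R <= 1 by move: qm; rewrite -natr1; lra.
  have qh0 : 0 < q - m%:R by rewrite subr_gt0.
  have L : ln 2 <= ln (2 / (q - m%:R)).
    by rewrite ler_ln ?posrE ?divr_gt0 // ler_pdivlMr // ler_piMr.
  have A0 : ln 2 <= A.
    rewrite -[leLHS]mul1r /A ler_pM // ?(ltW l0) //.
    by rewrite -[leLHS]sqrtr1 ler_wsqrtr // ler1n.
  have B0 : 0 <= B by rewrite mulr_ge0 ?sqrtr_ge0 // ln_ge0 // ler1n.
  have m2 : (m < n./2)%N by rewrite -(ltr_nat R) (lt_trans mq).
  suff H : ln 2 * d%:R <= 200 * (A + B).
    rewrite mulrDl -[leLHS]addr0 lerD //; last first.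
      by rewrite mulr_ge0 // addr_ge0 // (le_trans (ltW l0)).
    by rewrite mulrAC ler_pdivlMr // mulrC.
  (* The damped certificate needs m + 2 < n, which fails here; the degree is then at most 4, and A
     >= ln 2 absorbs it. *)
  have [n2|n3] := leqP n 2.
    have /(dle _) := full => d4.
    have {d4} : (d <= 2 * 2)%N.
      by rewrite (leq_trans d4) // leq_mul2l (leq_trans (leq_subr _ _)).
    rewrite -(ler_nat R) => d4.
    apply: le_trans (_ : ln 2 * 4 <= _); first by rewrite ler_pM2l.
    by lra.
  have Kn : (m.+2 < n)%N by apply: ltn_half_addn2.
  have [b hb hd'] := damped_degree_le Kn qh0 qh1.
  apply: le_trans hd'; rewrite ler_pM2l // ler_nat; apply: dle.
  exact: mk_certificate_damped.
- move=> _; have := dle _ full; rewrite -(ler_nat R) natrM (natrB _ (ltnW mn)) => h.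
  apply: le_trans h _; apply: ler_wpM2r; first by rewrite subr_ge0 ler_nat ltnW.
  by rewrite lerDr divr_ge0 // ltW.
Qed.
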